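(* Let $E$ be a finite nonempty set and $u:2^E\to\mathbb{R}$. Then $u$ is ordinally w-concave if and only if both of the following hold: (M) for any $X,Y\in 2^E$ with $X\subset Y$, the family $\mathbf{C}_u(X,Y)$ is an M${}^\natural$-convex set; (N) for every $X,Y\in 2^E$ and every $Z\in[X\cap Y,X\cup Y]$, if $Z$ maximizes $u$ over $\mathbf{N}(Z)\cap[X\cap Y,X\cup Y]$, then $Z$ maximizes $u$ over $[X\cap Y,X\cup Y]$.
   Context: Notation: for $X\subseteq E$ and $x\in E\setminus X$, $X+x=X\cup\{x\}$; for $x\in X$, $X-x=X\setminus\{x\}$. The symbol $\emptyset$ is also used as a formal element not in $E$, with $X+\emptyset=X-\emptyset=X$. A function $u:2^E\to\mathbb{R}$ is ordinally w-concave if for every $X,X'\in 2^E$ with $X\neq X'$ there exist distinct $x\in(X\setminus X')\cup\{\emptyset\}$ and $x'\in(X'\setminus X)\cup\{\emptyset\}$ such that (i) $u(X)<u(X-x+x')$, or (ii) $u(X')<u(X'-x'+x)$, or (iii) $u(X)=u(X-x+x')$ and $u(X')=u(X'-x'+x)$. For $X\subseteq Y\subseteq E$, $[X,Y]=\{Z\in 2^E\mid X\subseteq Z\subseteq Y\}$ and $\mathbf{C}_u(X,Y)=\operatorname{Arg}\max\{u(Z)\mid Z\in[X,Y]\}$. For $X\in 2^E$, the neighborhood is $\mathbf{N}(X)=\{X-x+x'\mid x\in X\cup\{\emptyset\},\ x'\in(E\setminus X)\cup\{\emptyset\}\}$. A nonempty family $\mathcal{F}\subseteq 2^E$ is an M${}^\natural$-convex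 set (generalized matroid) if for all $X,Y\in\mathcal{F}$ and every $x\in X\setminus Y$ there exists $y\in(Y\setminus X)\cup\{\emptyset\}$ with $X-x+y\in\mathcal{F}$ and $Y+x-y\in\mathcal{F}$. *)

(* Defs.v *)
From mathcomp Require Import all_boot all_order all_algebra.
From mathcomp Require Import reals.

Set Implicit Arguments.
Unset Strict Implicit.
Unset Printing Implicit Defensive.

Import Order.TTheory GRing.Theory Num.Theory.
Local Open Scope ring_scope.

Section FormalEmpty.
Variable E : finType.
Implicit Types (X Y Z : {set E}) (x y : option E).

(* The formal element, written as an empty set symbol on paper, is [None];
   a genuine element [a] of [E] is [Some a]. *)
Definition oset x : {set E} := if x is Some a then [set a] else set0.

Definition oadd X x : {set E} := X :|: oset x.
Definition osub X x : {set E} := X :\: oset x.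

(* X together with the formal element *)
Definition withe X : {set option E} := None |: (Some @: X).

End FormalEmpty.

Notation "X :+o x" := (oadd X x) (at level 50, left associativity).
Notation "X :-o x" := (osub X x) (at level 50, left associativity).

Definition ordinally_w_concave (R : realType) (E : finType)
    (u : {set E} -> R) : Prop :=
  forall X X' : {set E}, X <> X' ->
  exists x x' : option E,
    [/\ x \in withe (X :\: X'), x' \in withe (X' :\: X), x <> x'
      & [\/ u X < u (X :-o x :+o x'),
            u X' < u (X' :-o x' :+o x)
          | u X = u (X :-o x :+o x') /\ u X' = u (X' :-o x' :+o x)]].

Definition set_interval (E : finType) (X Y : {set E}) : {set {set E}} :=
  [set Z : {set E} | (X \subset Z) && (Z \subset Y)].

Definition argmax_set (R : realType) (E : finType) (u : {set E} -> R)
    (F : {set {set E}}) : {set {set E}} :=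
  [set Z in F | [forall W in F, u W <= u Z]].

Definition choice_family (R : realType) (E : finType) (u : {set E} -> R)
    (X Y : {set E}) : {set {set E}} :=
  argmax_set u (set_interval X Y).

Definition neighborhood (E : finType) (X : {set E}) : {set {set E}} :=
  [set X :-o x :+o x' | x in withe X, x' in withe (~: X)].

Definition Mnat_convex (E : finType) (F : {set {set E}}) : Prop :=
  F <> set0 /\
  forall X Y : {set E}, X \in F -> Y \in F ->
  forall x : E, x \in X :\: Y ->
  exists y : option E,
    [/\ y \in withe (Y :\: X),
        X :-o Some x :+o y \in F
      & Y :+o Some x :-o y \in F].

(* Main.v *)
Require Import Defs.
From mathcomp Require Import all_boot all_order all_algebra.
From mathcomp Require Import reals.

(** An ordinally w-concave [u] makes each family of maximizers satisfy a weak
    exchange property, in which the exchanged pair cannot be prescribed.  The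
    heart of the proof is that weak exchange implies the M-natural exchange.
    By induction on the size of the symmetric difference of [A] and [B], let
    [a] in [A :\: B] and let [(x, x')] be a weakly exchangeable pair; if [a]
    cannot be exchanged, the closer pairs [(A - x + x', B)] and
    [(A, B + x - x')] exchange [a] with elements [y1] and [y2], and exchanges
    inside two cubes of dimension at most 4, one near [A] and one near [B],
    show that [a] is exchangeable with [x'] after all.  Property (N) follows by
    considering a maximizer closest to the local maximizer [Z]. *)

Set Implicit Arguments.
Unset Strict Implicit.
Unset Printing Implicit Defensive.

Import Order.TTheory.

(** * Formal elements, symmetric differences and the two exchange properties *)

Section WeakExchange.
Variable E : finType.
Implicit Types (X Y Z A B C : {set E}) (F : {set {set E}}).
Implicit Types (x y : option E).

Lemma in_oadd X x (z : E) : (z \in X :+o x) = (z \in X) || (z \in oset x).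
Proof. by rewrite inE. Qed.

Lemma in_osub X x (z : E) : (z \in X :-o x) = (z \notin oset x) && (z \in X).
Proof. by rewrite inE. Qed.

Lemma in_oset_Some (z : E) : z \in oset (Some z).
Proof. exact: set11. Qed.

Lemma in_osetP x (z : E) : reflect (x = Some z) (z \in oset x).
Proof.
case: x => [a|] /=; last by rewrite inE; right.
by apply: (iffP set1P) => [->|[->]].
Qed.

Lemma mem_withe X x :
  reflect (forall z, z \in oset x -> z \in X) (x \in withe X).
Proof.
rewrite /withe !inE; case: x => [a|] /=; last by left=> z; rewrite inE.
apply: (iffP imsetP) => [[b bX [->]] z /set1P-> //|H].
by exists a => //; apply: H; rewrite set11.
Qed.

Lemma oset_neq x y : x <> y -> exists z, (z \in oset x) || (z \in oset y).
Proof.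
case: x y => [a|] [b|] // _;
  by [exists a; rewrite in_oset_Some | exists b; rewrite in_oset_Some orbT].
Qed.

Definition symdiff X Y := (X :\: Y) :|: (Y :\: X).

Definition exchange F X Y := forall a, a \in X :\: Y ->
  exists y, [/\ y \in withe (Y :\: X),
    X :-o Some a :+o y \in F & Y :+o Some a :-o y \in F].

Definition weak_exchange F X Y := exists x x',
  [/\ x \in withe (X :\: Y), x' \in withe (Y :\: X), x <> x',
    X :-o x :+o x' \in F & Y :-o x' :+o x \in F].

(** Counting memberships makes disjointness a pointwise boolean condition and lets [None] occur
    several times in [l], since [oset None] is empty. *)
Definition disjoint_options C (l : seq (option E)) := forall z,
  (z \in C) + count (fun x => z \in oset x) l <= 1.

End WeakExchange.

(** Set identities are checked at one point [z]: each membership becomes a free boolean, and all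
    truth values are tried. *)
Ltac bool_atoms :=
  repeat match goal with
  | |- context [@in_mem ?T ?a ?b] => generalize (@in_mem T a b)
  end;
  repeat match goal with |- forall b : bool, _ => case => //= end;
  intros;
  repeat match goal with H : is_true true -> _ |- _ => specialize (H isT) end;
  by [].

Arguments oset : simpl never.

(** * From weak exchange to M-natural exchange *)

Section Exchange.
Variable E : finType.
Implicit Types (X Y Z A B C : {set E}) (F : {set {set E}}).
Implicit Types (x y p q r s : option E).

(** Exchanging [s] out of [C :+o r :+o s] leaves only [q], [p] or the formal element as partner, one
    for each alternative. A formal [s] falls under the third. *)
Lemma exchange_three F C p q r s :
  disjoint_options C [:: p; q; r; s] ->
  exchange F (C :+o r :+o s) (C :+o p :+o q) ->
  C :+o p :+o q \in F -> C :+o r :+o s \in F ->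
  [\/ C :+o r :+o q \in F /\ C :+o p :+o s \in F,
      C :+o r :+o p \in F /\ C :+o q :+o s \in F
    | C :+o r \in F /\ C :+o p :+o q :+o s \in F].
Proof.
move=> dis exF pqF rsF.
have addN X : X :+o None = X by rewrite /oadd /= setU0.
case: s => [a|] in dis exF rsF *; last first.
  by rewrite addN in rsF; constructor 3; rewrite addN.
have [|y [/mem_withe yP yF1 yF2]] := exF a.
  rewrite !(in_setD, in_oadd); move: (dis a); rewrite /= in_oset_Some; bool_atoms.
have E1 : C :+o r :+o Some a :-o Some a :+o y = C :+o r :+o y.
  apply/setP=> z; move: (dis z) (yP z).
  rewrite !(in_oadd, in_osub, in_setD) /=; bool_atoms.
case: y => [b|] in yP yF1 yF2 E1 *; last first.
  rewrite E1 addN in yF1; constructor 3; split=> //.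
  suff <- : C :+o p :+o q :+o Some a :-o None = C :+o p :+o q :+o Some a by [].
  by rewrite /osub /= setD0.
rewrite E1 in yF1; move: (yP b (in_oset_Some b)).
rewrite in_setD !in_oadd => /andP[bN /orP[/orP[bC|/in_osetP pb]|/in_osetP qb]].
- by move: bN; rewrite bC.
- constructor 2; rewrite pb; split=> //; move: yF2; congr (_ \in F).
  apply/setP=> z; move: (dis z); rewrite !(in_oadd, in_osub) pb /=; bool_atoms.
- constructor 1; rewrite qb; split=> //; move: yF2; congr (_ \in F).
  apply/setP=> z; move: (dis z); rewrite !(in_oadd, in_osub) qb /=; bool_atoms.
Qed.

(** Exchanging [q] between a set and its subset [C] can only use the formal element as partner. *)
Lemma exchange_square F C q s :
  disjoint_options C [:: q; s] ->
  exchange F (C :+o q :+o s) C -> C \in F -> C :+o q :+o s \in F ->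
  C :+o q \in F.
Proof.
move=> dis exF CF qsF.
case: q => [a|] in dis exF qsF *; last by rewrite /oadd /= setU0.
have [|y [/mem_withe yP _]] := exF a.
  rewrite !(in_setD, in_oadd); move: (dis a); rewrite /= in_oset_Some; bool_atoms.
congr (_ \in F); apply/setP=> z; move: (yP z).
rewrite !(in_oadd, in_osub, in_setD) /=; bool_atoms.
Qed.

(** Exchange [s] in one direction and [q] in the other: either the goal appears, or both [C :+o r]
    and [C :+o r :+o q :+o s] are in [F]. The square between these two would then contain the
    excluded [C :+o r :+o q]. *)
Lemma exchange_cube F C p q r s :
  disjoint_options C [:: p; q; r; s] ->
  (forall X Y, X \in F -> Y \in F ->
     symdiff X Y \subset oset p :|: oset q :|: oset r :|: oset s ->
     exchange F X Y) ->
  C :+o p :+o q \in F -> C :+o r :+o s \in F -> C :+o r :+o q \notin F ->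
  C :+o r :+o p \in F.
Proof.
move=> dis exF pqF rsF /negP rqF.
have sub X Y : (forall z, z \in symdiff X Y ->
    [|| z \in oset p, z \in oset q, z \in oset r | z \in oset s]) ->
    symdiff X Y \subset oset p :|: oset q :|: oset r :|: oset s.
  by move=> H; apply/subsetP=> z /H; rewrite !in_setU -!orbA.
have ex1 : exchange F (C :+o r :+o s) (C :+o p :+o q).
  apply: exF => //; apply: sub => z.
  rewrite !(in_setU, in_setD, in_oadd); bool_atoms.
have ex2 : exchange F (C :+o p :+o q) (C :+o r :+o s).
  apply: exF => //; apply: sub => z.
  rewrite !(in_setU, in_setD, in_oadd); bool_atoms.
have [[]//|[]//|[rF _]] := exchange_three dis ex1 pqF rsF.
have dis' : disjoint_options C [:: r; s; p; q].
  by move=> z; move: (dis z) => /=; bool_atoms.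
have [[_]//|[]|[_ qrsF]] := exchange_three dis' ex2 rsF pqF.
  by rewrite /oadd -!setUA [oset p :|: _]setUC.
have Eq : C :+o r :+o s :+o q = C :+o r :+o q :+o s.
  by rewrite /oadd -!setUA [oset s :|: _]setUC.
rewrite Eq in qrsF; case: rqF; apply: (exchange_square _ _ rF qrsF).
  by move=> z; move: (dis z); rewrite in_oadd /=; bool_atoms.
apply: exF => //; apply: sub => z.
rewrite !(in_setU, in_setD, in_oadd); bool_atoms.
Qed.

Lemma weak_exchange_exchange F :
  (forall X Y, X \in F -> Y \in F -> X <> Y -> weak_exchange F X Y) ->
  forall X Y, X \in F -> Y \in F -> exchange F X Y.
Proof.
move=> weak A B; have [n] := ubnP #|symdiff A B|; elim: n => // n IH in A B *.
rewrite ltnS => ABn AF BF a aAB.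
have {}IH X Y : X \in F -> Y \in F -> symdiff X Y \proper symdiff A B ->
    exchange F X Y.
  by move=> XF YF /proper_card lt; apply: IH => //; apply: leq_trans ABn.
have [aA aB] : a \in A /\ a \notin B by move: aAB; rewrite inE => /andP[].
have [|x [x' [/mem_withe xP /mem_withe x'P xx' A'F B'F]]] := weak A B AF BF.
  by move=> AB; rewrite AB setDv inE in aAB.
have [xa|xa] := eqVneq x (Some a).
  exists x'; split; [exact/mem_withe | by rewrite -xa |].
  move: B'F; congr (_ \in F); apply/setP=> z; move: (xP z) (x'P z).
  rewrite !(in_setU, in_setD, in_oadd, in_osub) -xa; bool_atoms.
have ax : (a \in oset x) = false by apply/in_osetP/eqP.
have IH1 X Y z : X \in F -> Y \in F -> symdiff X Y \subset symdiff A B ->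
    z \in symdiff A B -> z \notin symdiff X Y -> exchange F X Y.
  move=> XF YF sXY zAB zXY; apply: IH => //; apply/properP; split=> //.
  by exists z.
(* Being distinct, [x] and [x'] are not both formal; an actual element [w] among them leaves the
   symmetric difference in both closer pairs. *)
have [w wx] := oset_neq xx'.
have wAB : w \in symdiff A B.
  move: wx (xP w) (x'P w); rewrite !(in_setU, in_setD); bool_atoms.
have aA' : a \in A :-o x :+o x' :\: B.
  rewrite !(in_setU, in_setD, in_oadd, in_osub) aA aB ax; bool_atoms.
have aB' : a \in A :\: (B :-o x' :+o x).
  rewrite !(in_setU, in_setD, in_oadd, in_osub) aA (negPf aB) ax.
  bool_atoms.
have [||y1 [/mem_withe y1P y1A y1B]] := IH1 _ _ w A'F BF _ wAB _ _ aA'.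
- apply/subsetP=> z; move: (xP z) (x'P z).
  rewrite !(in_setU, in_setD, in_oadd, in_osub); bool_atoms.
- move: wx (xP w) (x'P w).
  rewrite !(in_setU, in_setD, in_oadd, in_osub); bool_atoms.
have [||y2 [/mem_withe y2P y2A y2B]] := IH1 _ _ w AF B'F _ wAB _ _ aB'.
- apply/subsetP=> z; move: (xP z) (x'P z).
  rewrite !(in_setU, in_setD, in_oadd, in_osub); bool_atoms.
- move: wx (xP w) (x'P w).
  rewrite !(in_setU, in_setD, in_oadd, in_osub); bool_atoms.
have y1W : y1 \in withe (B :\: A).
  apply/mem_withe=> z /y1P; move: (xP z).
  rewrite !(in_setU, in_setD, in_oadd, in_osub); bool_atoms.
have y2W : y2 \in withe (B :\: A).
  apply/mem_withe=> z /y2P; move: (xP z) (x'P z).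
  rewrite !(in_setU, in_setD, in_oadd, in_osub); bool_atoms.
(* [y1] already works on the side of [B] and [y2] on the side of [A]; only the opposite halves can
   fail. *)
have [y1G|y1N] := boolP (A :-o Some a :+o y1 \in F); first by exists y1.
have [y2G|y2N] := boolP (B :+o Some a :-o y2 \in F); first by exists y2.
have y12 : y1 != y2 by apply: contraNneq y1N => ->.
have facts z : [/\ z \in oset x -> z \in A :\: B, z \in oset x' -> z \in B :\: A,
    z \in oset y1 -> z \in B :\: A, z \in oset y2 -> z \in B :\: A
    & [/\ z \in oset (Some a) -> z \in A :\: B,
    ~~ ((z \in oset x) && (z \in oset (Some a))),
    ~~ ((z \in oset y1) && (z \in oset x')),
    ~~ ((z \in oset y2) && (z \in oset x'))
    & ~~ ((z \in oset y1) && (z \in oset y2))]].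
  split; [exact: xP|exact: x'P|by apply/mem_withe|by apply/mem_withe|split].
  - by move=> /set1P->.
  - by apply/negP=> /andP[/in_osetP xz /in_osetP az]; rewrite xz az eqxx in xa.
  - apply/negP=> /andP[/y1P]; rewrite !(in_setD, in_oadd); bool_atoms.
  - apply/negP=> /andP[/y2P + x'z]; move: (x'P z x'z) (xP z).
    rewrite !(in_setD, in_oadd, in_osub) x'z; bool_atoms.
  - by apply/negP=> /andP[/in_osetP y1z /in_osetP y2z]; rewrite y1z y2z eqxx in y12.
(* Sets differing only in these four options agree on [a], so the induction hypothesis covers both
   cubes. *)
have IH2 : forall X Y, X \in F -> Y \in F ->
    symdiff X Y \subset oset x' :|: oset y1 :|: oset x :|: oset y2 ->
    exchange F X Y.
  move=> X Y XF YF /subsetP sXY; apply: (IH1 X Y a) => //.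
  - apply/subsetP=> z /sXY; case: (facts z).
    rewrite !(in_setU, in_setD) => + + + + _; bool_atoms.
  - by rewrite in_setU aAB.
  apply/negP=> /sXY; have [_ + + + _] := facts a.
  rewrite !(in_setU, in_setD) aA ax; bool_atoms.
exists x'; split; first exact/mem_withe.
(* Cube over [A :-o Some a :-o x]: adding [x', y1] or [x, y2] lands in [F], adding [x, y1] does not,
   hence adding [x, x'] does. *)
- have -> : A :-o Some a :+o x' = A :-o Some a :-o x :+o x :+o x'.
    apply/setP=> z; have [+ + + + [+ + + + +]] := facts z.
    rewrite !(in_setU, in_setD, in_oadd, in_osub); bool_atoms.
  apply: (@exchange_cube F _ x' y1 x y2) => //.
  + move=> z; have [+ + + + [+ + + + +]] := facts z.
    rewrite /= !(in_setU, in_setD, in_oadd, in_osub); bool_atoms.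
  + move: y1A; congr (_ \in F).
    apply/setP=> z; have [+ + + + [+ + + + +]] := facts z.
    rewrite !(in_setU, in_setD, in_oadd, in_osub); bool_atoms.
  + move: y2A; congr (_ \in F).
    apply/setP=> z; have [+ + + + [+ + + + +]] := facts z.
    rewrite !(in_setU, in_setD, in_oadd, in_osub); bool_atoms.
  + move: y1N; congr (_ \notin F).
    apply/setP=> z; have [+ + + + [+ + + + +]] := facts z.
    rewrite !(in_setU, in_setD, in_oadd, in_osub); bool_atoms.
(* Cube over [D]: adding [y2, x'] or [y1, x] lands in [F], adding [y1, x'] does not, hence adding
   [y1, y2] does. *)
- pose D := B :+o Some a :-o x' :-o y1 :-o y2.
  have -> : B :+o Some a :-o x' = D :+o y1 :+o y2.
    apply/setP=> z; have [+ + + + [+ + + + +]] := facts z.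
    rewrite !(in_setU, in_setD, in_oadd, in_osub); bool_atoms.
  apply: (@exchange_cube F _ y2 x' y1 x) => //.
  + move=> z; have [+ + + + [+ + + + +]] := facts z.
    rewrite /= !(in_setU, in_setD, in_oadd, in_osub); bool_atoms.
  + move=> X Y XF YF sXY; apply: IH2 => //; apply: subset_trans sXY _.
    apply/subsetP=> z; rewrite !in_setU; bool_atoms.
  + move: y1B; congr (_ \in F).
    apply/setP=> z; have [+ + + + [+ + + + +]] := facts z.
    rewrite !(in_setU, in_setD, in_oadd, in_osub); bool_atoms.
  + move: y2B; congr (_ \in F).
    apply/setP=> z; have [+ + + + [+ + + + +]] := facts z.
    rewrite !(in_setU, in_setD, in_oadd, in_osub); bool_atoms.
  + move: y2N; congr (_ \notin F).
    apply/setP=> z; have [+ + + + [+ + + + +]] := facts z.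
    rewrite !(in_setU, in_setD, in_oadd, in_osub); bool_atoms.
Qed.

Lemma weak_exchange_sym F X Y : weak_exchange F X Y -> weak_exchange F Y X.
Proof. by case=> x [x' [xP x'P /nesym xx' XF YF]]; exists x', x. Qed.

Lemma exchange_weak_exchange F X Y a :
  a \in X :\: Y -> exchange F X Y -> weak_exchange F X Y.
Proof.
move=> aXY exF; have [y [/mem_withe yP XF YF]] := exF a aXY.
have aP z : z \in oset (Some a) -> z \in X :\: Y by move/set1P->.
exists (Some a), y; split=> //; [exact/mem_withe | exact/mem_withe | |].
  move=> ya; move: (yP a) aXY; rewrite -ya in_oset_Some !in_setD; bool_atoms.
move: YF; congr (_ \in F); apply/setP=> z; move: (aP z) (yP z).
rewrite !(in_setD, in_oadd, in_osub); bool_atoms.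
Qed.

End Exchange.

Local Open Scope ring_scope.

(** * Maximizers of an ordinally w-concave function over an interval *)

Section Concavity.
Variables (R : realType) (E : finType) (u : {set E} -> R).
Implicit Types (X Y Z A B W : {set E}) (F : {set {set E}}).

Lemma argmaxP F Z :
  reflect (Z \in F /\ forall W, W \in F -> u W <= u Z) (Z \in argmax_set u F).
Proof.
rewrite inE; apply: (iffP andP) => -[ZF]; first by move/forall_inP.
by move=> H; split=> //; apply/forall_inP.
Qed.

Lemma in_interval X Y Z :
  reflect (forall z, (z \in X -> z \in Z) /\ (z \in Z -> z \in Y))
    (Z \in set_interval X Y).
Proof.
rewrite inE; apply: (iffP andP) => [[/subsetP XZ /subsetP ZY] z|H].
  by split; [apply: XZ | apply: ZY].
by split; apply/subsetP=> z; case: (H z).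
Qed.

Lemma interval_exchange X Y A B x x' :
  A \in set_interval X Y -> B \in set_interval X Y ->
  x \in withe (A :\: B) -> x' \in withe (B :\: A) ->
  A :-o x :+o x' \in set_interval X Y.
Proof.
move=> /in_interval AI /in_interval BI /mem_withe xP /mem_withe x'P.
apply/in_interval=> z; have [XA AY] := AI z; have [XB BY] := BI z.
split; move: XA AY XB BY (xP z) (x'P z);
  rewrite !(in_setD, in_oadd, in_osub); bool_atoms.
Qed.

Lemma argmax_nonempty F : F != set0 -> exists Z, Z \in argmax_set u F.
Proof.
case/set0Pn=> Z0 Z0F; have [Z ZF Zmax] := arg_maxP u Z0F.
by exists Z; apply/argmaxP.
Qed.

(** The exchanged sets stay in the interval, so for two maximizers the strict alternatives (i) and
    (ii) are impossible, and (iii) is a weak exchange among maximizers. *)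
Lemma concave_choice_convex X Y :
  ordinally_w_concave u -> X \proper Y -> Mnat_convex (choice_family u X Y).
Proof.
move=> conc /proper_sub XY; split.
  have [|Z ZF] := @argmax_nonempty (set_interval X Y).
    by apply/set0Pn; exists X; rewrite inE subxx.
  by move=> F0; rewrite -[argmax_set _ _]/(choice_family u X Y) F0 inE in ZF.
apply: weak_exchange_exchange => A B /argmaxP[AI Amax] /argmaxP[BI Bmax] AB.
have [x [x' [xP x'P xx' uP]]] := conc A B AB.
have A'I := interval_exchange AI BI xP x'P.
have B'I := interval_exchange BI AI x'P xP.
exists x, x'; case: uP => [|| [uA uB]].
- by rewrite ltNge Amax.
- by rewrite ltNge Bmax.
- by split=> //; apply/argmaxP; rewrite -?uA -?uB.
Qed.

(** * Neighborhoods and local maxima *)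

Lemma neighborhood_exchange Z W x x' :
  x \in withe (Z :\: W) -> x' \in withe (W :\: Z) ->
  Z :-o x :+o x' \in neighborhood Z.
Proof.
move=> /mem_withe xP /mem_withe x'P; apply/imset2P; exists x x' => //.
  by apply/mem_withe=> z /xP; rewrite inE => /andP[].
by apply/mem_withe=> z /x'P; rewrite !inE => /andP[].
Qed.

Lemma concave_local_max X Y Z :
  ordinally_w_concave u -> Z \in set_interval X Y ->
  Z \in argmax_set u (neighborhood Z :&: set_interval X Y) ->
  Z \in argmax_set u (set_interval X Y).
Proof.
move=> conc ZI /argmaxP[_ Zmax].
have [|W0 W0max] := @argmax_nonempty (set_interval X Y).
  by apply/set0Pn; exists Z.
have [W /argmaxP[WI Wmax] Wmin] :=
  @arg_minnP _ W0 _ (fun W => #|symdiff Z W|) W0max.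
have [->|/eqP ZW] := eqVneq Z W; first exact/argmaxP.
have [x [x' [xP x'P xx' uP]]] := conc Z W ZW.
have Z'I := interval_exchange ZI WI xP x'P.
have W'I := interval_exchange WI ZI x'P xP.
(* Alternative (i) contradicts local maximality of [Z], (ii) maximality of [W]; (iii) moves [W] to a
   maximizer strictly closer to [Z]. *)
case: uP => [|| [_ uW]].
- by rewrite ltNge Zmax // inE Z'I (neighborhood_exchange xP x'P).
- by rewrite ltNge Wmax.
have /Wmin : W :-o x' :+o x \in argmax_set u (set_interval X Y).
  by apply/argmaxP; rewrite -uW.
rewrite leqNgt => /negP[]; apply/proper_card.
move/mem_withe: xP => xP; move/mem_withe: x'P => x'P.
apply/properP; split.
  apply/subsetP=> z; move: (xP z) (x'P z).
  rewrite !(in_setU, in_setD, in_oadd, in_osub); bool_atoms.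
have [w wx] := oset_neq xx'.
exists w; move: wx (xP w) (x'P w);
  rewrite !(in_setU, in_setD, in_oadd, in_osub); bool_atoms.
Qed.

(* A neighbor of [X] inside the interval differs from [X] only by removing an
   element of [X :\: X'] and adding one of [X' :\: X]. *)
Lemma improving_exchange X X' :
  (X \in argmax_set u (neighborhood X :&: set_interval (X :&: X') (X :|: X')) ->
   X \in argmax_set u (set_interval (X :&: X') (X :|: X'))) ->
  X \notin argmax_set u (set_interval (X :&: X') (X :|: X')) ->
  exists x x', [/\ x \in withe (X :\: X'), x' \in withe (X' :\: X), x <> x'
    & u X < u (X :-o x :+o x')].
Proof.
move=> locmax Xnmax; set I := set_interval _ _ in locmax Xnmax.
have XI : X \in I by rewrite inE subsetIl subsetUl.
have XN : X \in neighborhood X.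
  apply/imset2P; exists None None; rewrite /withe ?inE //.
  by rewrite /oadd /osub setD0 setU0.
have : X \notin argmax_set u (neighborhood X :&: I).
  by apply: contra Xnmax.
rewrite inE [X \in _ :&: _]inE XN XI /= => /forall_inPn[W].
rewrite inE -ltNge => /andP[/imset2P[x x' /mem_withe xP /mem_withe x'P ->]].
move=> /in_interval WI ltu; exists x, x'; split=> //.
- apply/mem_withe=> z zx; have [+ _] := WI z; move: (xP z zx) (x'P z).
  rewrite !(in_setI, in_setC, in_setD, in_oadd, in_osub) zx; bool_atoms.
- apply/mem_withe=> z zx; have [_ +] := WI z; move: (x'P z zx).
  rewrite !(in_setU, in_setC, in_setD, in_oadd, in_osub) zx; bool_atoms.
- move=> xx'; move: ltu; suff -> : X :-o x :+o x' = X by rewrite ltxx.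
  apply/setP=> z; move: (xP z) (x'P z).
  rewrite xx' !(in_setC, in_oadd, in_osub); bool_atoms.
Qed.

End Concavity.

Theorem theorem2p11 (R : realType) (E : finType) (E_nonempty : (0 < #|E|)%N)
    (u : {set E} -> R) :
  ordinally_w_concave u <->
  (forall X Y : {set E}, X \proper Y -> Mnat_convex (choice_family u X Y)) /\
  (forall X Y Z : {set E},
     Z \in set_interval (X :&: Y) (X :|: Y) ->
     Z \in argmax_set u (neighborhood Z :&: set_interval (X :&: Y) (X :|: Y)) ->
     Z \in argmax_set u (set_interval (X :&: Y) (X :|: Y))).
Proof.
split=> [conc|[convex locmax] X X' XX'].
  split=> [X Y XY|X Y Z]; first exact: concave_choice_convex.
  exact: concave_local_max.
(* Converse: if [X] or [X'] does not maximize [u] over [I], then (N) supplies an improving neighbor,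
   giving (i) or (ii). If both maximize, (M) on [I] gives (iii). *)
set I := set_interval (X :&: X') (X :|: X').
have XI : X \in I by rewrite inE subsetIl subsetUl.
have X'I : X' \in I by rewrite inE subsetIr subsetUr.
have [Xmax|/improving_exchange[|x [x' [xP x'P xx' ltu]]]] :=
  boolP (X \in argmax_set u I); first last.
- by exists x, x'; split=> //; constructor 1.
- exact: locmax.
have [X'max|] := boolP (X' \in argmax_set u I); last first.
  rewrite /I setIC setUC => /improving_exchange[|x' [x [x'P xP xx' ltu]]].
    by apply: locmax; rewrite setIC setUC.
  by exists x, x'; split=> //; [move/esym | constructor 2].
have [_ exch] : Mnat_convex (argmax_set u I).
  apply: convex; rewrite properEneq (subset_trans (subsetIl _ _) (subsetUl _ _)).
  rewrite andbT; apply/eqP=> IU; apply: XX'.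
  by apply/setP=> z; move/setP/(_ z): IU; rewrite in_setI in_setU; bool_atoms.
have eq_max Y Y' : Y \in argmax_set u I -> Y' \in argmax_set u I -> u Y = u Y'.
  move=> /argmaxP[YI Ymax] /argmaxP[Y'I Y'max].
  by apply/eqP; rewrite eq_le Y'max // Ymax.
have [x [x' [xP x'P xx' X1 X2]]] : weak_exchange (argmax_set u I) X X'.
  (* The exchange must start from an element of a difference; when [X :\: X'] is empty, the roles of
     [X] and [X'] are swapped. *)
  have [sub|/subsetPn[a aX aX']] := boolP (X \subset X').
    have [sub'|/subsetPn[a aX' aX]] := boolP (X' \subset X).
      by case: XX'; apply/eqP; rewrite eqEsubset sub.
    apply/weak_exchange_sym/(@exchange_weak_exchange _ _ _ _ a).
      by rewrite inE aX.
    exact: exch.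
  by apply: (@exchange_weak_exchange _ _ _ _ a); [rewrite inE aX' | exact: exch].
by exists x, x'; split=> //; constructor 3; split; apply: eq_max.
Qed.
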